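(* Let $p$ be an odd prime, $S\subseteq SL_2(\mathbb{F}_p)$, and $P=A\times B\subseteq(\mathbb{F}_p^2\times\mathbb{F}_p^2)\setminus\{(0,0,0,0)\}$. Assume every line through the origin contains at most $k$ points of $B$. Then \[I(P,S)\lesssim\frac{|A||B||S|^{1/2}}{p^{1/2}}+k^{1/2}p^{1/2}|A|^{1/2}|B|^{1/2}|S|^{1/2}+k|S|.\]
   Context: $I(P,S)$ is the number of pairs $((x,y),\theta)\in P\times S$ with $\theta y=x$ (matrices acting on column vectors). A line through the origin is a one-dimensional subspace of $\mathbb{F}_p^2$. $X\lesssim Y$ means $X\le C\log_2 p\cdot Y$ for a constant $C$ independent of $p,A,B,S,k$. *)

(* Defs.v *)
From mathcomp Require Import all_boot all_order all_algebra.
From mathcomp Require Import reals exp.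

Set Implicit Arguments.
Unset Strict Implicit.
Unset Printing Implicit Defensive.

Import GRing.Theory.
Local Open Scope ring_scope.

(* For prime p, 'F_p is the field with p elements. *)
Definition SL2 (p : nat) : {set 'M['F_p]_2} := [set theta | \det theta == 1].

Definition incidences (p : nat) (P : {set 'cV['F_p]_2 * 'cV['F_p]_2})
    (S : {set 'M['F_p]_2}) : nat :=
  #|[set w in setX P S | w.2 *m w.1.2 == w.1.1]|.

Definition log2 (R : realType) (x : R) : R := ln x / ln 2.

(* Main.v *)
Require Import Defs.
From mathcomp Require Import all_boot all_order all_algebra.
From mathcomp Require Import all_fingroup mxabelem.
From mathcomp Require Import reals exp.
From mathcomp Require Import ring.

Set Implicit Arguments.
Unset Strict Implicit.
Unset Printing Implicit Defensive.

Import Order.TTheory GRing.Theory Num.Theory.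
Local Open Scope ring_scope.

(* Cauchy-Schwarz over S, followed by enlarging S to all of SL_2, reduces the
   bound to the energy, which counts the triples (theta, u, v) with theta in
   SL_2, u = (x, y) and v = (x', y') in P, theta y = x and theta y' = x'.  If
   det(y, y') <> 0, at most one theta serves u and v, and only when
   det(x, x') = det(y, y'); if v is a multiple of u, at most p do.  The condition
   det(x, x') = det(y, y') says that u is orthogonal to v for a symplectic form
   on F_p^4, so these pairs are counted by a second moment bound for incidences
   between points and hyperplanes.  At most k points of P lie on a line of
   F_p^4, so the energy is at most |P|^2 / p + 2 p k |P|. *)

(** * Cauchy-Schwarz and counting on hyperplanes over a finite field *)

Lemma cauchy_schwarz (R : realFieldType) (I : finType) (P : pred I)
    (a b : I -> R) :
  (\sum_(i | P i) a i * b i) ^+ 2 <=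
    (\sum_(i | P i) a i ^+ 2) * (\sum_(i | P i) b i ^+ 2).
Proof.
set X := \sum_(i | P i) a i ^+ 2; set Y := \sum_(i | P i) b i ^+ 2.
set Z := \sum_(i | P i) a i * b i.
have X0 : 0 <= X by apply: sumr_ge0 => i _; exact: sqr_ge0.
have quad s t : 0 <= s ^+ 2 * X - s * t * Z *+ 2 + t ^+ 2 * Y.
  have -> : s ^+ 2 * X - s * t * Z *+ 2 + t ^+ 2 * Y =
            \sum_(i | P i) (s * a i - t * b i) ^+ 2.
    rewrite !mulr_sumr -sumrMnl -sumrB -big_split /=.
    by apply: eq_bigr => i _; ring.
  by apply: sumr_ge0 => i _; exact: sqr_ge0.
have [X_eq0|X_neq0] := eqVneq X 0; last first.
  have Xgt0 : 0 < X by rewrite lt_def X_neq0.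
  (* For [t = X] the quadratic form is minimal at [s = Z]; its value there is [X] times the wanted
     difference. *)
  have := quad Z X.
  have -> : Z ^+ 2 * X - Z * X * Z *+ 2 + X ^+ 2 * Y = X * (X * Y - Z ^+ 2).
    by ring.
  by rewrite pmulr_rge0 // subr_ge0.
rewrite X_eq0 mul0r {1}/Z big1 ?expr0n // => i Pi.
suff -> : a i = 0 by rewrite mul0r.
apply/eqP; rewrite -sqrf_eq0; apply/eqP.
by apply: (psumr_eq0P _ X_eq0) => // j _; exact: sqr_ge0.
Qed.

Lemma card_mulmx_eq0 (F : finFieldType) (m n : nat) (M : 'M[F]_(m, n)) :
  #|[set w : 'rV_m | w *m M == 0]| = (#|F| ^ (m - \rank M))%N.
Proof.
rewrite -mxrank_ker -card_rowg; apply: eq_card => w.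
by rewrite inE mem_rowg; apply/eqP/sub_kermxP.
Qed.

Lemma card_hyperplane (F : finFieldType) (n : nat) (v : 'rV[F]_n) :
  v != 0 -> #|[set w : 'rV_n | w *m v^T == 0]| = (#|F| ^ n.-1)%N.
Proof. by move=> v0; rewrite card_mulmx_eq0 mxrank_tr rank_rV v0 subn1. Qed.

(** Both conditions together say that [w] is killed by [row_mx v^T v'^T]. Its rank is 2, because the
    line of [v] is strictly smaller than the span of [v] and [v']. *)
Lemma card_hyperplaneI (F : finFieldType) (n : nat) (v v' : 'rV[F]_n) :
  v != 0 -> ~~ (v' <= v)%MS ->
  #|[set w : 'rV_n | (w *m v^T == 0) && (w *m v'^T == 0)]| =
    (#|F| ^ (n - 2))%N.
Proof.
move=> v0 nv'.
have v'0 : v' != 0 by apply: contraNneq nv' => ->; exact: sub0mx.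
have rk : \rank (row_mx v^T v'^T) = 2%N.
  rewrite -tr_col_mx mxrank_tr -addsmxE; apply/eqP; rewrite eqn_leq.
  have := (mxrank_adds_leqif v v').1; rewrite !rank_rV v0 v'0 => -> /=.
  have lt_v : (v < v + v')%MS.
    rewrite ltmxE addsmxSl /=; apply: contra nv'; apply: submx_trans.
    exact: addsmxSr.
  by have := rank_ltmx lt_v; rewrite rank_rV v0.
rewrite -rk -card_mulmx_eq0; apply: eq_card => w.
rewrite !inE mul_mx_row; apply/andP/eqP => [[/eqP -> /eqP ->]|].
  exact: row_mx0.
by rewrite -(row_mx0 F 1 1 1) => /eq_row_mx [-> ->].
Qed.

Lemma sum_bool (R : pzSemiRingType) (T : finType) (b : pred T) :
  \sum_t (b t)%:R = #|[set t | b t]|%:R :> R.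
Proof. by rewrite -natr_sum -sum1dep_card [in RHS]big_mkcond. Qed.

Lemma sum_if (R : pzSemiRingType) (T : finType) (A : {set T}) (b : pred T)
    (c : R) :
  \sum_(t in A) (if b t then c else 0) = #|[set t in A | b t]|%:R * c.
Proof.
rewrite -big_mkcondr -sum1dep_card natr_sum mulr_suml.
by apply: eq_bigr => t _; rewrite mul1r.
Qed.

(** * Second moment bound for points and hyperplanes *)

Section PointHyperplane.
Variables (R : realFieldType) (F : finFieldType) (n : nat).
Local Notation q := (#|F|%:R : R).

Let q_gt0 : 0 < q.
Proof. by rewrite ltr0n ltnW // card_finNzRing_gt1. Qed.

(** The indicator of orthogonality with its mean removed: for [v != 0], a share of exactly [q^-1] of
    all [w] is orthogonal to [v]. *)
Definition deviation (w v : 'rV[F]_n.+2) : R := (w *m v^T == 0)%:R - q^-1.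

(** Orthogonality to two independent vectors behaves like two independent events, so the covariance
    vanishes. For proportional vectors the hyperplanes coincide, and the sum is [q ^+ n.+2] times
    the variance [q^-1 * (1 - q^-1)]. *)
Lemma sum_deviationM (v v' : 'rV[F]_n.+2) : v != 0 -> v' != 0 ->
  \sum_(w : 'rV[F]_n.+2) deviation w v * deviation w v' =
    if (v' <= v)%MS then q ^+ n * (q - 1) else 0.
Proof.
move=> v0 v'0.
have -> : \sum_(w : 'rV[F]_n.+2) deviation w v * deviation w v' =
    \sum_(w : 'rV[F]_n.+2) ((w *m v^T == 0) && (w *m v'^T == 0))%:R
    - q^-1 * \sum_(w : 'rV[F]_n.+2) (w *m v^T == 0)%:R - q^-1 * \sum_(w : 'rV[F]_n.+2) (w *m v'^T == 0)%:R
    + \sum_(w : 'rV[F]_n.+2) q^-1 ^+ 2.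
  rewrite !mulr_sumr -!sumrB -big_split /=; apply: eq_bigr => w _.
  by rewrite /deviation -mulnb natrM; ring.
rewrite !sum_bool !card_hyperplane // sumr_const card_mx mul1n /=.
have qn0 := lt0r_neq0 q_gt0.
case: ifPn => [vv'|nvv']; last first.
  rewrite card_hyperplaneI // subn2 /= -[q^-1 ^+ 2 *+ _]mulr_natr !natrX !(exprS, expr0).
  by field.
have -> : #|[set w : 'rV[F]_n.+2 | (w *m v^T == 0) && (w *m v'^T == 0)]|
    = (#|F| ^ n.+1)%N.
  rewrite -(card_hyperplane v0); apply: eq_card => w; rewrite !inE.
  have [wv|//] := eqVneq (w *m v^T) 0.
  have /sub_rVP[c ->] := vv'.
  by rewrite linearZ -scalemxAr wv scaler0 eqxx.
by rewrite -[q^-1 ^+ 2 *+ _]mulr_natr !natrX !(exprS, expr0); field.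
Qed.


Variables (T : finType) (P : {set T}) (phi psi : T -> 'rV[F]_n.+2) (k : nat).
Hypothesis phi_neq0 : {in P, forall t, phi t != 0}.
Hypothesis psi_neq0 : {in P, forall t, psi t != 0}.
Hypothesis phi_line :
  {in P, forall t, (#|[set s in P | (phi s <= phi t)%MS]| <= k)%N}.
Hypothesis psi_line :
  {in P, forall t, (#|[set s in P | (psi s <= psi t)%MS]| <= k)%N}.

Local Notation G w := (\sum_(s in P) deviation w (psi s)).

(** After expanding the square, only pairs with proportional [psi] survive, at most [k] for each
    [t]. *)
Lemma sum_deviation_sqr :
  \sum_(w : 'rV[F]_n.+2) (G w) ^+ 2 <= #|P|%:R * k%:R * (q ^+ n * (q - 1)).
Proof.
have q1 : 0 <= q ^+ n * (q - 1).
  by rewrite mulr_ge0 ?exprn_ge0 ?(ltW q_gt0) // subr_ge0 ler1n -(ltr0n R) q_gt0.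
have -> : \sum_(w : 'rV[F]_n.+2) (G w) ^+ 2 = \sum_(t in P) \sum_(s in P)
    \sum_(w : 'rV[F]_n.+2) deviation w (psi t) * deviation w (psi s).
  under eq_bigr => w _ do rewrite expr2 mulr_suml.
  rewrite exchange_big; apply: eq_bigr => t _ /=.
  by under eq_bigr => w _ do rewrite mulr_sumr; rewrite exchange_big.
rewrite -mulrA mulr_natl -sumr_const; apply: ler_sum => t Pt.
rewrite (eq_bigr (fun s => if (psi s <= psi t)%MS then q ^+ n * (q - 1)
                           else 0)); last first.
  by move=> s Ps; rewrite sum_deviationM ?psi_neq0.
rewrite sum_if ler_wpM2r //.
by rewrite ler_nat; exact: psi_line.
Qed.

(* The deviation is invariant under scaling the first argument, so averaging
   over the nonzero multiples of each [phi t] gains a factor [q - 1] over a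
   direct application of Cauchy-Schwarz. *)
Lemma point_hyperplane :
  (\sum_(t in P) G (phi t)) ^+ 2 <= q ^+ n * (#|P|%:R * k%:R) ^+ 2.
Proof.
(* [h w] counts the ways to write [w] as a nonzero multiple of some [phi t]; it is the weight paired
   with [G] in Cauchy-Schwarz. *)
pose h w : R := \sum_(t in P) \sum_(c : F | c != 0) (w == c *: phi t)%:R.
have q1_gt0 : 0 < q - 1 :> R.
  by rewrite subr_gt0 ltr1n card_finNzRing_gt1.
have cardF0 : \sum_(c : F | c != 0) (1 : R) = q - 1.
  have -> : q = \sum_(c : F) 1 by rewrite sumr_const.
  by rewrite [in RHS](bigD1 0) //= [RHS]addrC addKr.
have hG : \sum_(w : 'rV[F]_n.+2) h w * G w = (q - 1) * \sum_(t in P) G (phi t).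
  under eq_bigr => w _ do rewrite mulr_suml.
  rewrite exchange_big mulr_sumr; apply: eq_bigr => t Pt /=.
  under eq_bigr => w _ do rewrite mulr_suml.
  rewrite exchange_big -cardF0 mulr_suml; apply: eq_bigr => c c0 /=.
  rewrite (bigD1 (c *: phi t)) //= eqxx [X in _ + X]big1 ?addr0 => [|w /negPf->]; last first.
    by rewrite mul0r.
  rewrite !mul1r; apply: eq_bigr => s _; rewrite /deviation -scalemxAl.
  by rewrite scaler_eq0 (negPf c0).
have h2 : \sum_(w : 'rV[F]_n.+2) h w ^+ 2 <= (q - 1) * (#|P|%:R * k%:R).
  have -> : \sum_(w : 'rV[F]_n.+2) h w ^+ 2 = \sum_(t in P) \sum_(c : F | c != 0)
      h (c *: phi t).
    under eq_bigr => w _ do rewrite expr2 {1}/h mulr_suml.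
    rewrite exchange_big; apply: eq_bigr => t Pt /=.
    under eq_bigr => w _ do rewrite mulr_suml.
    rewrite exchange_big; apply: eq_bigr => c c0 /=.
    rewrite (bigD1 (c *: phi t)) //= eqxx [X in _ + X]big1 ?addr0 ?mul1r // => w /negPf->.
    by rewrite mul0r.
  rewrite mulrCA -cardF0 mulr_natl -sumr_const; apply: ler_sum => t Pt.
  rewrite mulr_suml; apply: ler_sum => c c0; rewrite mul1r.
  apply: (@le_trans _ _ (#|[set s in P | (phi s <= phi t)%MS]|%:R)); last first.
    by rewrite ler_nat; exact: phi_line.
  rewrite -[leRHS]mulr1 -sum_if; apply: ler_sum => s Ps.
  (* Since [phi s != 0], at most one [d] matches a given [s], and a match puts [phi s] on the line
     of [phi t]. *)
  have [/eqP|] := boolP [forall d : F, (d != 0) ==> (c *: phi t != d *: phi s)].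
    move=> /eqP/forallP H; rewrite big1; first by case: ifP.
    by move=> d d0; have := H d; rewrite d0 /= => /negPf->.
  move=> /forallPn[d]; rewrite negb_imply negbK => /andP[d0 /eqP eq_d].
  rewrite (bigD1 d) //= eq_d eqxx big1 => [|e /andP[_ /negPf ne]].
    rewrite addr0; case: ifPn => // /sub_rVP[]; exists (d^-1 * c).
    by rewrite -scalerA eq_d scalerK.
  rewrite -subr_eq0 -scalerBl scaler_eq0 subr_eq0 eq_sym ne /=.
  by rewrite (negPf (phi_neq0 Ps)).
have := cauchy_schwarz predT h (fun w => G w); rewrite hG.
move=> /le_trans/(_ (ler_pM _ _ h2 sum_deviation_sqr)).
move=> /(_ (sumr_ge0 _ _) (sumr_ge0 _ _)) H.
have {}H := H (fun _ _ => sqr_ge0 _) (fun _ _ => sqr_ge0 _).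
rewrite -(ler_pM2l (exprn_gt0 2 q1_gt0)) -exprMn.
by apply: (le_trans H); rewrite le_eqVlt; apply/orP; left; apply/eqP; ring.
Qed.

End PointHyperplane.

(** * Determinants in the plane and the symplectic form on four-space *)

Section SL2Action.
Variable F : fieldType.
Implicit Types (x y z : 'cV[F]_2) (M : 'M[F]_2) (u v : 'cV[F]_2 * 'cV[F]_2).

(** The determinant of the matrix with columns [x] and [y]. *)
Definition cross x y : F := x 0 0 * y 1 0 - x 1 0 * y 0 0.

Lemma cV2_eq x y : x 0 0 = y 0 0 -> x 1 0 = y 1 0 -> x = y.
Proof.
move=> e0 e1; apply/colP => i; case: (unliftP 0 i) => [j ->|->] //.
by rewrite ord1; move: e1; congr (x _ _ = y _ _); exact: val_inj.
Qed.

Lemma mulmx_cV2 M x i : (M *m x) i 0 = M i 0 * x 0 0 + M i 1 * x 1 0.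
Proof.
rewrite mxE !big_ord_recl big_ord0 addr0.
by do 2?congr (_ + _ * _); congr (_ _ _); exact: val_inj.
Qed.

Lemma det2 M : \det M = M 0 0 * M 1 1 - M 0 1 * M 1 0.
Proof.
have lift01 : lift 0 0 = 1 :> 'I_2 by exact: val_inj.
have lift10 : lift 1 0 = 0 :> 'I_2 by exact: val_inj.
rewrite (expand_det_row _ 0) !big_ord_recl big_ord0 /cofactor !det_mx11 !mxE.
by rewrite !lift01 lift10 /= ; ring.
Qed.

Lemma cross_mulmx M x y : cross (M *m x) (M *m y) = \det M * cross x y.
Proof. by rewrite /cross !mulmx_cV2 det2; ring. Qed.

Lemma cV2_neq0 x : x != 0 -> (x 0 0 != 0) || (x 1 0 != 0).
Proof.
apply: contraNT; rewrite negb_or !negbK => /andP[/eqP x0 /eqP x1].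
by apply/eqP/cV2_eq; rewrite mxE.
Qed.

Lemma cross_eq0 x y : x != 0 -> cross x y = 0 -> exists c, y = c *: x.
Proof.
move=> /cV2_neq0/orP[] x0 /eqP; rewrite subr_eq0 => /eqP e.
  exists (y 0 0 / x 0 0); apply: cV2_eq; rewrite mxE; first by field.
  by apply: (mulfI x0); rewrite e; field.
exists (y 1 0 / x 1 0); apply: cV2_eq; rewrite mxE; last by field.
by apply: (mulfI x0); rewrite -e; field.
Qed.

Lemma cross_neq0 x : x != 0 -> exists z, cross x z != 0.
Proof.
move=> /cV2_neq0/orP[] x0.
  by exists (delta_mx 1 0); rewrite /cross !mxE /= mulr0 mulr1 subr0.
by exists (delta_mx 0 0); rewrite /cross !mxE /= mulr0 mulr1 sub0r oppr_eq0.
Qed.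

Lemma mulmx_cross_inj M M' y z : cross y z != 0 ->
  M *m y = M' *m y -> M *m z = M' *m z -> M = M'.
Proof.
move=> yz ey ez; suff H (v : 'cV_2) : M *m v = M' *m v.
  by apply/matrixP => i j; move: (H (delta_mx j 0)) => /colP/(_ i);
     rewrite -!colE !mxE.
(* Cramer's rule in the basis [y], [z]. *)
have -> : v = (cross v z / cross y z) *: y + (cross y v / cross y z) *: z.
  by move: yz; rewrite /cross => yz; apply: cV2_eq; rewrite !mxE; field.
by rewrite !mulmxDr -!scalemxAr ey ez.
Qed.

(* [cross x x' - cross y y'] is the pairing of [coords (x, y)] with
   [cocoords (x', y')]. *)
Definition coords u : 'rV[F]_4 :=
  \row_j [:: u.1 0 0; u.1 1 0; u.2 0 0; u.2 1 0]`_j.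
Definition cocoords u : 'rV[F]_4 :=
  \row_j [:: u.1 1 0; - u.1 0 0; - u.2 1 0; u.2 0 0]`_j.

Lemma coords_cocoords u v :
  (coords u *m (cocoords v)^T == 0) = (cross u.1 v.1 == cross u.2 v.2).
Proof.
have -> : coords u *m (cocoords v)^T = (cross u.1 v.1 - cross u.2 v.2)%:M.
  apply/matrixP => i j; rewrite !ord1 !mxE !big_ord_recl big_ord0 !mxE /=.
  by rewrite /cross; ring.
rewrite -[RHS]subr_eq0; apply/eqP/eqP => [/matrixP/(_ 0 0)|->].
  by rewrite !mxE eqxx mulr1n.
by apply/matrixP => i j; rewrite !mxE mul0rn.
Qed.


Lemma coords_lineP u v :
  reflect (exists c, v = (c *: u.1, c *: u.2)) (coords v <= coords u)%MS.
Proof.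
apply: (iffP sub_rVP) => -[c e]; exists c; last first.
  by apply/rowP => -[[|[|[|[|?]]]] ?] //; rewrite e !mxE.
have H (i : 'I_4) : coords v 0 i = c * coords u 0 i by rewrite e mxE.
case: v {e} H => v1 v2 H; congr (_, _); apply: cV2_eq; rewrite mxE.
- by have := H 0; rewrite !mxE.
- by have := H 1; rewrite !mxE.
- by have := H 2; rewrite !mxE.
- by have := H 3; rewrite !mxE.
Qed.

(** [cocoords] is a signed permutation of the entries of [coords], so both have the same
    proportional pairs and one line bound serves for points and hyperplanes alike. *)
Lemma cocoords_lineP u v :
  reflect (exists c, v = (c *: u.1, c *: u.2)) (cocoords v <= cocoords u)%MS.
Proof.
apply: (iffP sub_rVP) => -[c e]; exists c; last first.
  by apply/rowP => -[[|[|[|[|?]]]] ?] //; rewrite e !mxE //= mulrN.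
have H (i : 'I_4) : cocoords v 0 i = c * cocoords u 0 i by rewrite e mxE.
case: v {e} H => v1 v2 H; congr (_, _); apply: cV2_eq; rewrite mxE.
- by have := H 1; rewrite !mxE /= mulrN => /oppr_inj.
- by have := H 0; rewrite !mxE.
- by have := H 3; rewrite !mxE.
- by have := H 2; rewrite !mxE /= mulrN => /oppr_inj.
Qed.

Lemma coords_neq0 u : u.2 != 0 -> coords u != 0.
Proof.
apply: contraNneq => u0; apply/eqP/cV2_eq; rewrite mxE.
  by have /rowP/(_ 2) := u0; rewrite !mxE.
by have /rowP/(_ 3) := u0; rewrite !mxE.
Qed.

Lemma cocoords_neq0 u : u.2 != 0 -> cocoords u != 0.
Proof.
apply: contraNneq => u0; apply/eqP/cV2_eq; rewrite mxE.
  by have /rowP/(_ 3) := u0; rewrite !mxE.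
by have /rowP/(_ 2) := u0; rewrite !mxE => /eqP; rewrite oppr_eq0 => /eqP.
Qed.

End SL2Action.

(** Elements of [SL2 p] preserve [cross], so a single solution already forces the orthogonality. If
    [u.2] and [v.2] are independent, they determine [theta]; otherwise [v] is a multiple of [u], and
    one free parameter in the field remains. *)
Lemma card_SL2_transport (p : nat) (u v : 'cV['F_p]_2 * 'cV['F_p]_2) :
  u.2 != 0 ->
  (#|[set theta in SL2 p | (theta *m u.2 == u.1) && (theta *m v.2 == v.1)]| <=
   (coords u *m (cocoords v)^T == 0)%R +
   (if (coords v <= coords u)%MS then #|'F_p| else 0))%N.
Proof.
case: u v => [x y] [x' y'] /= y0; rewrite coords_cocoords /=.
set E := [set theta in _ | _].
have EP theta : theta \in E ->
    [/\ \det theta = 1, theta *m y = x & theta *m y' = x'].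
  by rewrite !inE => /and3P[/eqP ? /eqP ? /eqP ?].
have [->|/set0Pn[M0 M0E]] := eqVneq E set0; first by rewrite cards0.
have [d0 e0 e0'] := EP _ M0E.
have -> /= : cross x x' == cross y y'.
  by rewrite -e0 -e0' cross_mulmx d0 mul1r.
have [yy'|yy'] := eqVneq (cross y y') 0; last first.
  apply: leq_trans (leq_addr _ _).
  apply/card_le1_eqP => M M' /EP[_ ex ex'] /EP[_ fx fx'].
  by apply: (mulmx_cross_inj yy'); rewrite ?ex ?ex' ?fx ?fx'.
have [c yE] := cross_eq0 y0 yy'.
have -> : (coords (x', y') <= coords (x, y))%MS.
  by apply/coords_lineP; exists c; rewrite -e0' yE -scalemxAr e0.
apply: leq_trans (leq_addl _ _).
(* Completing [y] to a basis by [z], each [theta] in [E] is determined by [theta *m z]. As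
   [cross x (theta *m z) = cross y z] is fixed, this image lies on the affine line through [M0 *m z]
   with direction [x]. *)
have [z yz] := cross_neq0 y0.
have x0 : x != 0.
  apply: contraNneq yz => x0.
  by rewrite -[cross y z]mul1r -d0 -cross_mulmx e0 x0 /cross !mxE !mul0r subrr.
have injz : {in E &, injective (fun M : 'M['F_p]_2 => M *m z)}.
  by move=> M M' /EP[_ e _] /EP[_ f _]; apply: (mulmx_cross_inj yz); rewrite e f.
rewrite -(card_in_imset injz) -cardsT.
apply: leq_trans (leq_imset_card (fun c => M0 *m z + c *: x) _).
apply: subset_leq_card; apply/subsetP => _ /imsetP[M /EP[d e _] ->].
have [|b bE] := @cross_eq0 _ x (M *m z - M0 *m z) x0; last first.
  by apply/imsetP; exists b; rewrite ?inE // -bE addrC subrK.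
have : cross x (M *m z) = cross x (M0 *m z).
  by rewrite -{1}e -e0 !cross_mulmx d d0.
move: (M *m z) (M0 *m z) => w w0; rewrite /cross !mxE => /eqP.
by rewrite -subr_eq0 => /eqP <-; ring.
Qed.

(** * The energy bound and the resulting incidence bound *)

Section Energy.
Variables (p : nat) (A B : {set 'cV['F_p]_2}) (k : nat).
Hypothesis B_line : forall L : {vspace 'cV['F_p]_2},
  \dim L = 1%N -> (#|[set b in B | b \in L]| <= k)%N.

(** A pair with second component zero can only be incident if it is [(0, 0)]. Dropping such pairs
    makes all the vectors [coords u] and [cocoords u] nonzero. *)
Let P := [set u in setX A B | u.2 != 0].

(** As [u.2 != 0], a multiple of [u] is determined by its second component, which is an element of
    [B] on the line of [u.2]. *)
Lemma card_coords_line :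
  {in P, forall u, (#|[set v in P | (coords v <= coords u)%MS]| <= k)%N}.
Proof.
move=> u; rewrite inE => /andP[_ u0].
set E := [set v in P | _].
have EP v : v \in E -> v.2 \in B /\ exists c, v = (c *: u.1, c *: u.2).
  by rewrite !inE => /andP[/andP[/andP[_ ->] _] /coords_lineP].
have inj2 : {in E &, injective snd}.
  move=> _ _ /EP[_ [c ->]] /EP[_ [d ->]] /= /eqP.
  by rewrite -subr_eq0 -scalerBl scaler_eq0 (negPf u0) orbF subr_eq0 => /eqP ->.
rewrite -(card_in_imset inj2).
apply: leq_trans (B_line (L := <[u.2]>%VS) _); last by rewrite dim_vline u0.
apply/subset_leq_card/subsetP => _ /imsetP[v /EP[Bv [c e]] ->].
by rewrite inE Bv; apply/vlineP; exists c; rewrite e.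
Qed.

Lemma energy_le (R : realFieldType) : prime p ->
  \sum_(theta in SL2 p) (#|[set u in P | theta *m u.2 == u.1]|%:R : R) ^+ 2 <=
    #|P|%:R ^+ 2 / p%:R + (p%:R * k%:R * #|P|%:R) *+ 2.
Proof.
move=> p_prime.
have P0 u : u \in P -> u.2 != 0 by rewrite inE => /andP[].
have cardF : #|'F_p| = p by rewrite card_Fp.
have p0 : p%:R != 0 :> R by rewrite pnatr_eq0 -lt0n prime_gt0.
pose N0 : R := \sum_(u in P) \sum_(v in P) (coords u *m (cocoords v)^T == 0)%:R.
have N0_le : N0 <= #|P|%:R ^+ 2 / p%:R + p%:R * k%:R * #|P|%:R.
  (* The ambient dimension 4 is [n.+2] with [n = 2], so the deviation of [N0] from
     [#|P|%:R ^+ 2 / p%:R] is at most [p * k * #|P|] after taking roots. *)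
  have := @point_hyperplane R _ 2 _ P (@coords _) (@cocoords _) k.
  move=> /(_ (fun u Pu => coords_neq0 (P0 u Pu))).
  move=> /(_ (fun u Pu => cocoords_neq0 (P0 u Pu)) card_coords_line).
  have line' : {in P, forall u,
      (#|[set v in P | (cocoords v <= cocoords u)%MS]| <= k)%N}.
    move=> u /card_coords_line; apply: leq_trans; apply: subset_leq_card.
    apply/subsetP => v; rewrite !inE => /andP[-> /cocoords_lineP vu] /=.
    exact/coords_lineP.
  move=> /(_ line'); rewrite cardF.
  have -> : \sum_(u in P) \sum_(v in P) deviation R (coords u) (cocoords v) =
      N0 - #|P|%:R ^+ 2 / p%:R.
    rewrite /deviation cardF; under eq_bigr do rewrite sumrB sumr_const.
    by rewrite sumrB sumr_const -mulrnA -[p%:R^-1 *+ _]mulr_natl natrM expr2.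
  have Y0 : 0 <= p%:R * (#|P|%:R * k%:R) :> R by rewrite !mulr_ge0.
  rewrite -exprMn -lerBlDl -[_ * k%:R * _]mulrA [k%:R * _]mulrC => H.
  (* Squares can be compared only for a nonnegative deviation; a negative one satisfies the bound at
     once. *)
  have [X0|/ltW X0] := lerP 0 (N0 - #|P|%:R ^+ 2 / p%:R); last exact: le_trans Y0.
  by rewrite -(@ler_pXn2r _ 2) ?nnegrE.
have -> : \sum_(theta in SL2 p) (#|[set u in P | theta *m u.2 == u.1]|%:R : R) ^+ 2
  = \sum_(u in P) \sum_(v in P) #|[set theta in SL2 p |
      (theta *m u.2 == u.1) && (theta *m v.2 == v.1)]|%:R.
  under eq_bigr => theta _.
    rewrite -[_%:R]mulr1 -sum_if expr2 mulr_suml.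
    under eq_bigr do rewrite mulr_sumr.
    over.
  rewrite exchange_big; apply: eq_bigr => u _ /=.
  rewrite exchange_big; apply: eq_bigr => v _ /=.
  rewrite -[RHS]mulr1 -sum_if; apply: eq_bigr => theta _.
  by do 2?case: ifP; rewrite ?(mulr0, mul0r, mulr1).
apply: (@le_trans _ _ (N0 + p%:R * k%:R * #|P|%:R)); last first.
  by rewrite mulr2n addrA lerD2r.
(* The first summand adds up to [N0]; the second gives [p] for each of the at most [k * #|P|]
   proportional pairs. *)
apply: (@le_trans _ _ (\sum_(u in P) \sum_(v in P)
    ((coords u *m (cocoords v)^T == 0)%:R +
     (if (coords v <= coords u)%MS then p%:R else 0)))).
  apply: ler_sum => u Pu; apply: ler_sum => v Pv.
  have := card_SL2_transport v (P0 u Pu); rewrite cardF -(ler_nat R) natrD.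
  by case: ifP.
under eq_bigr => u Pu do rewrite big_split /= sum_if.
rewrite big_split /= lerD2l mulrAC -mulr_suml.
rewrite mulrC [leRHS]mulrAC -[leRHS]mulrA ler_wpM2l //.
rewrite mulr_natr -sumr_const; apply: ler_sum => u Pu.
by rewrite ler_nat card_coords_line.
Qed.

Lemma incidences_le (R : rcfType) (S : {set 'M['F_p]_2}) : prime p ->
  S \subset SL2 p -> (0, 0) \notin setX A B ->
  (incidences (setX A B) S)%:R <= Num.sqrt #|S|%:R *
     (#|A|%:R * #|B|%:R / Num.sqrt p%:R + 
     Num.sqrt k%:R * Num.sqrt p%:R * Num.sqrt #|A|%:R * Num.sqrt #|B|%:R *+ 2)
   :> R.
Proof.
move=> p_prime S_sub nz.
pose f theta : R := #|[set u in P | theta *m u.2 == u.1]|%:R.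
have -> : (incidences (setX A B) S)%:R = \sum_(theta in S) f theta.
  rewrite /incidences.
  have -> : [set w in setX (setX A B) S | w.2 *m w.1.2 == w.1.1] =
     [set w in setX P S | w.2 *m w.1.2 == w.1.1].
    apply/setP => -[[x y] theta]; rewrite !inE /=.
    have [y0|] := eqVneq y 0; last by rewrite andbT.
    rewrite andbF /= y0 mulmx0; apply/negP => /andP[/andP[xy _] /eqP x0].
    by move: nz xy; rewrite in_setX -x0 => /negP.
  rewrite -[LHS]mulr1 -sum_if; under [RHS]eq_bigr => theta _ do
    rewrite /f -[_%:R]mulr1 -sum_if.
  rewrite exchange_big pair_big /=; apply: eq_bigl => -[u theta].
  by rewrite in_setX.
have f2 : (\sum_(theta in S) f theta) ^+ 2 <=
   #|S|%:R * (#|P|%:R ^+ 2 / p%:R + (p%:R * k%:R * #|P|%:R) *+ 2).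
  have := cauchy_schwarz (mem S) (fun=> 1) f.
  under eq_bigr do rewrite mul1r.
  under [X in _ <= X * _]eq_bigr do rewrite expr1n.
  rewrite sumr_const => /le_trans; apply; rewrite ler_wpM2l //.
  apply: le_trans (energy_le _ p_prime).
  rewrite [leRHS](big_setID S) /= (setIidPr S_sub) lerDl.
  by apply: sumr_ge0 => *; exact: sqr_ge0.
have P_le : #|P|%:R <= #|A|%:R * #|B|%:R :> R.
  by rewrite -natrM ler_nat -cardsX; apply/subset_leq_card/subsetP => u; rewrite inE => /andP[].
set a := Num.sqrt #|A|%:R; set b := Num.sqrt #|B|%:R; set s := Num.sqrt _.
set q := Num.sqrt p%:R; set l := Num.sqrt k%:R.
have sq (m : nat) : Num.sqrt m%:R ^+ 2 = m%:R :> R by rewrite sqr_sqrtr.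
have q_gt0 : 0 < q by rewrite sqrtr_gt0 ltr0n prime_gt0.
have [a0 b0 s0 l0] : [/\ 0 <= a, 0 <= b, 0 <= s & 0 <= l].
  by rewrite !sqrtr_ge0.
have r0 : 0 <= s * (a ^+ 2 * b ^+ 2 / q + (l * q * a * b) *+ 2).
  by rewrite mulr_ge0 // addr_ge0 ?mulrn_wge0 // !(mulr_ge0, invr_ge0, sqr_ge0) // ltW.
rewrite -(sq #|A|) -(sq #|B|) -/a -/b.
rewrite -(@ler_pXn2r _ 2) ?nnegrE //; last by apply: sumr_ge0 => *.
apply: (le_trans f2); rewrite exprMn /s sq ler_wpM2l //.
apply: (@le_trans _ _ ((a ^+ 2 * b ^+ 2) ^+ 2 / q ^+ 2 +
    (q ^+ 2 * l ^+ 2 * (a ^+ 2 * b ^+ 2)) *+ 2)).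
  rewrite !sq lerD ?lerMn2r ?ler_wpM2r ?ler_wpM2l ?invr_ge0 ?mulr_ge0 //.
  by rewrite ler_pXn2r ?nnegrE // mulr_ge0.
(* With [U = a ^+ 2 * b ^+ 2 / q] and [V = l * q * a * b], the claim is that [U ^+ 2 + 2 * V ^+ 2]
   is at most [(U + 2 * V) ^+ 2]; the surplus is [2 * V ^+ 2 + 4 * U * V]. *)
rewrite -subr_ge0.
have -> : (a ^+ 2 * b ^+ 2 / q + l * q * a * b *+ 2) ^+ 2 -
  ((a ^+ 2 * b ^+ 2) ^+ 2 / q ^+ 2 +
   q ^+ 2 * l ^+ 2 * (a ^+ 2 * b ^+ 2) *+ 2) =
   (a * b * l * q) ^+ 2 *+ 2 + a ^+ 3 * b ^+ 3 * l *+ 4.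
  by field; rewrite lt0r_neq0.
by rewrite addr_ge0 ?mulrn_wge0 ?sqr_ge0 // !mulr_ge0 // exprn_ge0.
Qed.

End Energy.

Theorem theorem2p11 (R : realType) :
  exists C : R,
  forall (p : nat) (S : {set 'M['F_p]_2}) (A B : {set 'cV['F_p]_2}) (k : nat),
    prime p -> odd p ->
    S \subset SL2 p ->
    (0, 0) \notin setX A B ->
    (forall L : {vspace 'cV['F_p]_2},
        \dim L = 1%N -> (#|[set b in B | b \in L]| <= k)%N) ->
    (incidences (setX A B) S)%:R <=
      C * log2 p%:R *
      (#|A|%:R * #|B|%:R * Num.sqrt #|S|%:R / Num.sqrt p%:R
       + Num.sqrt k%:R * Num.sqrt p%:R * Num.sqrt #|A|%:R
         * Num.sqrt #|B|%:R * Num.sqrt #|S|%:R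
       + k%:R * #|S|%:R).
Proof.
(* The constant 2 absorbs the doubled term of [incidences_le]. *)
exists 2 => p S A B k p_prime _ S_sub nz B_line.
(* Since [p] is at least 2, the logarithmic factor only enlarges the nonnegative right-hand side. *)
have log_ge1 : 1 <= log2 p%:R :> R.
  by rewrite /log2 ler_pdivlMr ?mul1r ?ln_gt0 ?ltr1n // ler_ln ?posrE ?ltr0n
             ?prime_gt0 // ler_nat prime_gt1.
apply: le_trans (incidences_le B_line _ p_prime S_sub nz) _.
set s := Num.sqrt _; set X := _ / _; set Y := _ * Num.sqrt #|B|%:R.
have [s0 X0 Y0] : [/\ 0 <= s, 0 <= X & 0 <= Y].
  by rewrite !(mulr_ge0, invr_ge0, sqrtr_ge0).
have -> : #|A|%:R * #|B|%:R * s / Num.sqrt p%:R = X * s by rewrite mulrAC.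
have Z0 : 0 <= k%:R * #|S|%:R :> R by rewrite mulr_ge0.
have W0 : 0 <= 2 * (X * s + Y * s + k%:R * #|S|%:R).
  by rewrite mulr_ge0 // !addr_ge0 // mulr_ge0.
rewrite mulrAC; apply: le_trans (ler_peMr W0 log_ge1).
have Xs0 := mulr_ge0 X0 s0; have Ys0 := mulr_ge0 Y0 s0.
rewrite -subr_ge0.
have -> : 2 * (X * s + Y * s + k%:R * #|S|%:R) - s * (X + Y *+ 2) =
  X * s + 2 * (k%:R * #|S|%:R) by ring.
by rewrite addr_ge0 // mulr_ge0.
Qed.
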